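(* Let $m,n$ be integers with $m,n\geq 1$ and let $0\leq k\leq n-1$. Then $|\mathcal{D}^m_n|=|\mathcal{D}^{m,k}_n|$; that is, the number of $k$-skeletal paths of height $n$ with values in $\mathbb{Z}$ for parameters $c=1$ and $m$ equals the number of augmented $m$-Dyck paths of height $n$ (and the paper gives an explicit bijection between these sets).
   Context: $\mathcal{D}^m_n$ (augmented $m$-Dyck paths of height $n$) is the set of lattice paths from $(0,0)$ to $(mn+1,n)$ consisting of unit north steps and unit east steps such that every lattice point visited before the last step satisfies $x\leq my$ (the path stays weakly above the line $x=my$), and the last step is an east step ending at $(mn+1,n)$. A path of height $n$ with values in $\mathbb{Z}$ is a set $\pi=\{(x_i,i):0\leq i\leq n-1\}$ with integers $x_0\leq\cdots\leq x_{n-1}$; it is $k$-skeletal for parameters $c=1$ and $m$ iff (P0) $x_0\geq 0$; (P1) $x_i<mi+1$ for all $i\in\{n-k-1,\ldots,n-1\}$; (P2) for every $i\in\{0,\ldots,n-k-1\}$ there is $j\in\{i,\ldots,i+k\}$ with $x_j\geq mj$. Such a path is identified with the lattice path from $(0,0)$ to $(mn,n)$ whose north steps go from $(x_i,i)$ to $(x_i,i+1)$, augmented with one final east step to $(mn+1,n)$; $\mathcal{D}^{m,k}_n$ is the set of these augmented paths. *)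

(* Defs.v *)
From mathcomp Require Import all_boot all_order all_algebra.
From mathcomp Require Import boolp classical_sets functions cardinality.
Set Implicit Arguments.
Unset Strict Implicit.
Unset Printing Implicit Defensive.

(* A lattice path starting at (0, 0) is the word of its unit steps. *)
Notation step := bool (only parsing).
Definition north : step := true.
Definition east : step := false.

(* The lattice point (x, y) reached after the first p steps of w. *)
Definition point_at (w : seq step) (p : nat) : nat * nat :=
  (count_mem east (take p w), count_mem north (take p w)).

Definition endpoint (w : seq step) : nat * nat := point_at w (size w).

(* A path from (0, 0) to (m * n + 1, n) has exactly (m * n).+1 + n steps, so
   the paths with these endpoints all live in this finite type. *)
Definition word (m n : nat) : finType := ((m * n).+1 + n).-tuple step.

Definition augmented_dyck (m n : nat) (w : word m n) : bool :=
  [&& endpoint w == ((m * n).+1, n),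
      [forall p : 'I_(size w), (point_at w p).1 <= m * (point_at w p).2]
    & last north w == east].

(* The set D^m_n. *)
Definition dyck_paths (m n : nat) : {set word m n} :=
  [set w : word m n | augmented_dyck w]%SET.

(* The set {(x_i, i) : 0 <= i <= n - 1} is encoded by the function i |-> x_i. *)
Definition height_path (n : nat) (x : {ffun 'I_n -> int}) : Prop :=
  forall i j : 'I_n, i <= j -> (x i <= x j)%R.

(* k-skeletal for the parameters c = 1 and m. *)
Definition skeletal (m n k : nat) (x : {ffun 'I_n -> int}) : Prop :=
  [/\ height_path x,
      forall i : 'I_n, i = 0 :> nat -> (0 <= x i)%R,
      forall i : 'I_n, n - k - 1 <= i -> (x i < (m * i + 1)%:Z)%R
    & forall i : 'I_n, i <= n - k - 1 ->
        exists j : 'I_n, i <= j <= i + k /\ ((m * j)%:Z <= x j)%R].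

Definition skeletal_paths (m n k : nat) : set {ffun 'I_n -> int} :=
  [set x | skeletal m k x]%classic.
Arguments skeletal_paths : clear implicits.

(* w is the path from (0, 0) to (m * n, n) whose north steps start at the
   points (x_i, i), followed by an east step. *)
Definition augmentation (m n : nat) (x : {ffun 'I_n -> int}) (w : word m n) :
    Prop :=
  exists u : seq step,
    [/\ w = rcons u east :> seq step,
        endpoint u = (m * n, n)
      & forall i : 'I_n, exists p : nat,
          [/\ p < size u, nth east u p = north,
              ((point_at u p).1%:Z)%R = x i & (point_at u p).2 = i]].

(* The set D^{m,k}_n. *)
Definition skeletal_lattice_paths (m n k : nat) : {set word m n} :=
  [set w : word m n |
    `[< exists x : {ffun 'I_n -> int}, skeletal m k x /\ augmentation x w >]]%SET.

(* Main.v *)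
Require Import Defs.
From mathcomp Require Import all_boot all_order all_algebra.
From mathcomp Require Import boolp classical_sets functions cardinality.
From mathcomp Require Import zify.
Set Implicit Arguments.
Unset Strict Implicit.
Unset Printing Implicit Defensive.
Import Order.TTheory GRing.Theory Num.Theory.

(* A path x is recorded by its cyclic gaps x_{i+1} - x_i, where x_n stands for
   x_0 + mn + 1; they form a sequence of n naturals with sum mn + 1.  Extend x
   to all indices by these gaps, so that the heights G_i = x_i - mi satisfy
   G_{i+n} = G_i + 1, and let M_i be the maximum of G_i, ..., G_{i+k}.  Then x
   is k-skeletal, up to a translation which (P1) and (P2) determine, exactly
   when M_{n-k-1} is smaller than every later value of M.  Since
   M_{i+n} = M_i + 1, this singles out one rotation of each gap sequence: n
   times the number of k-skeletal paths is the number of gap sequences,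
   whatever k.  The augmented m-Dyck paths are the case k = n - 1. *)

(** * Injections from relations, and steps counted in prefixes of a word *)

(** Choice turns the relation into an injective function. This suits correspondences that pass
    through an existentially quantified path. *)
Lemma leq_card_rel (A B : finType) (S : {set A}) (S' : {set B})
    (R : A -> B -> Prop) :
  (forall a, a \in S -> exists2 b, b \in S' & R a b) ->
  (forall a a' b, a \in S -> a' \in S -> R a b -> R a' b -> a = a') ->
  #|S| <= #|S'|.
Proof.
(* A member of [S] provides an element of [B], the default value outside [S]. *)
move=> tot inj; have [->|[a0 a0S]] := set_0Vmem S; first by rewrite cards0.
have /choice [f fP] : forall a, exists b, a \in S -> b \in S' /\ R a b.
  move=> a; case: (boolP (a \in S)) => [aS|_].
    by have [b bS' Rab] := tot a aS; exists b.
  by have [b _ _] := tot a0 a0S; exists b.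
have f_inj : {in S &, injective f}.
  move=> a a' aS a'S faa'; apply: (inj a a' (f a)) => //.
    by have [] := fP a aS.
  by rewrite faa'; have [] := fP a' a'S.
rewrite -(card_in_imset f_inj) subset_leq_card //.
by apply/fintype.subsetP => _ /imsetP[a aS ->]; have [] := fP a aS.
Qed.

Lemma count_take_leq (T : Type) (a : pred T) (s : seq T) (p q : nat) :
  p <= q -> count a (take p s) <= count a (take q s).
Proof.
move=> pq; rewrite -(take_takel s pq) -{2}(cat_take_drop p (take q s)).
by rewrite count_cat leq_addr.
Qed.

Lemma count_take_lt (s : seq bool) (p q : nat) :
  p < q -> nth east s p = north ->
  count_mem north (take p s) < count_mem north (take q s).
Proof.
move=> pq sp; have ps : p < size s.
  by rewrite ltnNge; apply: contra_eqN sp => /(nth_default east) ->.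
apply: leq_trans (count_take_leq _ _ pq).
by rewrite (take_nth east ps) -cats1 count_cat sp /= addn1.
Qed.

Lemma count_take_inj (s : seq bool) (p q : nat) :
  nth east s p = north -> nth east s q = north ->
  count_mem north (take p s) = count_mem north (take q s) -> p = q.
Proof.
move=> sp sq e; have [lt|lt|//] := ltngtP p q.
  by have := count_take_lt lt sp; rewrite e ltnn.
by have := count_take_lt lt sq; rewrite e ltnn.
Qed.

Lemma north_step_exists (s : seq bool) (i : nat) :
  i < count_mem north s ->
  exists p, [/\ p < size s, nth east s p = north &
                count_mem north (take p s) = i].
Proof.
elim: s i => [|b s IHs] i //=; case: b => /=.
  case: i => [_|i]; first by exists 0.
  by rewrite add1n ltnS => /IHs[p [ps sp <-]]; exists p.+1.
by rewrite add0n => /IHs[p [ps sp <-]]; exists p.+1.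
Qed.

Lemma point_at_sum (w : seq bool) (p : nat) :
  p <= size w -> (point_at w p).1 + (point_at w p).2 = p.
Proof.
move=> pw; rewrite -[RHS](size_takel pw) -(count_predC (pred1 east)) /=.
by congr (_ + _); apply: eq_count; case.
Qed.

(** * Words and the abscissae of their north steps *)

Section Words.
Variables (m n : nat).
Implicit Types (x : {ffun 'I_n -> int}) (w : word m n) (u : seq bool).

Lemma size_endpoint u a b : endpoint u = (a, b) -> size u = a + b.
Proof. by rewrite -[size u](point_at_sum (leqnn _)) -/(endpoint u) => ->. Qed.

Lemma augmentation_inj x x' w :
  augmentation x w -> augmentation x' w -> x = x'.
Proof.
move=> [u [wu eu ux]] [u' [wu' _ u'x]].
have {wu'}uu' : u = u'.
  by have /rcons_inj[] : rcons u east = rcons u' east by rewrite -wu -wu'.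
subst u'; apply/ffunP => i; have [p [_ up <- pi]] := ux i.
have [q [_ uq <- qi]] := u'x i.
by rewrite (count_take_inj up uq) // -[LHS]/((point_at u p).2) pi -qi.
Qed.

(** The step leaving (a, b) has index a + b, so the north step from (x_i, i) has index x_i + i;
    hence [x] determines the word. *)
Lemma augmentation_north x w u : w = rcons u east :> seq bool ->
  augmentation x w ->
  forall p, nth east u p = north <-> exists i, (x i + i%:Z = p%:Z)%R.
Proof.
move=> wu [u' [wu' eu ux]]; have {wu'}uu' : u = u'.
  by have /rcons_inj[] : rcons u east = rcons u' east by rewrite -wu -wu'.
subst u' => p; split=> [up|[i xip]].
  have pu : p < size u.
    by rewrite ltnNge; apply: contra_eqN up => /(nth_default east) ->.
  have lt : (point_at u p).2 < n.
    have -> : n = (endpoint u).2 by rewrite eu.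
    exact: count_take_lt.
  exists (Ordinal lt); have [q [qu uq qx qi]] := ux (Ordinal lt).
  have pq : q = p by apply: (count_take_inj uq up).
  by rewrite -qx pq /= -[in RHS](point_at_sum (ltnW pu)).
have [q [qu uq qx qi]] := ux i.
suff -> : p = q by [].
have := point_at_sum (ltnW qu); move: xip; rewrite -qx qi; lia.
Qed.

Lemma augmentation_fun x w w' :
  augmentation x w -> augmentation x w' -> w = w'.
Proof.
move=> a a'; move: (a) (a') => [u [wu eu _]] [u' [wu' eu' _]].
apply: val_inj; rewrite /= wu wu'; congr rcons.
have ss : size u = size u' by rewrite (size_endpoint eu) (size_endpoint eu').
apply: (eq_from_nth (x0 := east) ss) => p _.
have h := augmentation_north wu a p; have h' := augmentation_north wu' a' p.
rewrite /north in h h'.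
by apply/idP/idP => H; [apply/h'/h | apply/h/h'].
Qed.

Lemma augmentation_exists x : height_path x ->
  (forall i, 0 <= x i <= (m * n)%:Z)%R ->
  exists w : word m n, augmentation x w.
Proof.
move=> hx bx.
pose f p := [exists i : 'I_n, (x i + i%:Z == p%:Z)%R].
have sw : size (mkseq f ((m * n).+1 + n)) == (m * n).+1 + n.
  by rewrite size_mkseq.
exists (Tuple sw); exists (mkseq f (m * n + n)).
(* The index of the north step at height i; it increases strictly because [x] is nondecreasing. *)
pose y (i : 'I_n) := `|x i|%N + i.
have yE i p : (x i + i%:Z == p%:Z)%R = (y i == p).
  by rewrite /y; have := bx i; move: (x i) => z; lia.
have y_mono i j : (y i < y j) = (i < j).
  have := hx i j; have := hx j i; have := bx i; have := bx j.
  by rewrite /y; move: (x i) (x j) => a b; lia.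
have y_lt i : y i < m * n + n.
  by rewrite /y; have := bx i; have := ltn_ord i; move: (x i) => a; lia.
have y_inj : injective y.
  move=> i j e; apply: val_inj; have := y_mono i j; have := y_mono j i.
  by rewrite e ltnn => /esym/negbT h /esym/negbT h' /=; lia.
(* Double counting of the pairs (p, i) with y_i = p < q; each p occurs at most once as [y] is
   injective. *)
have cN q : q <= m * n + n ->
    count_mem north (take q (mkseq f (m * n + n))) = #|[pred i | y i < q]|.
  move=> qN; rewrite -map_take take_iota (minn_idPl qN) count_map.
  rewrite -sum1_count big_mkcond -sum1_card /=.
  rewrite (eq_bigr (fun p => \sum_(i : 'I_n) (y i == p))); last first.
    move=> p _; rewrite eqb_id; case: ifPn => [/existsP[i]|/existsPn fp].
      rewrite yE => /eqP yip; rewrite (bigD1 i) //= yip eqxx big1 // => j ji.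
      by rewrite -yip (inj_eq y_inj) (negbTE ji).
    by rewrite big1 // => i _; rewrite -yE (negbTE (fp i)).
  rewrite exchange_big [RHS]big_mkcond /=; apply: eq_bigr => i _; rewrite inE.
  transitivity (count_mem (y i) (iota 0 q)); last first.
    by rewrite count_uniq_mem ?iota_uniq // mem_iota add0n; case: ifP.
  rewrite -sum1_count [RHS]big_mkcond /=; apply: eq_bigr => p _.
  by rewrite eq_sym; case: eqP.
have su : size (mkseq f (m * n + n)) = m * n + n by rewrite size_mkseq.
have pE q : q <= m * n + n ->
    point_at (mkseq f (m * n + n)) q =
    (q - #|[pred i | y i < q]|, #|[pred i | y i < q]|).
  move=> qN; have := @point_at_sum (mkseq f (m * n + n)) q.
  rewrite su => /(_ qN); rewrite /point_at /= cN //.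
  move=> e; congr pair; apply/eqP; rewrite -(eqn_add2r #|[pred i | y i < q]|).
  by rewrite e subnK ?eqxx // -[X in _ <= X]e leq_addl.
split.
(* Every [y i] is below m n + n, so the additional last letter is east. *)
- rewrite /= addSn mkseqS; suff -> : f (m * n + n) = east by [].
  apply/existsP => -[i]; rewrite yE; have := y_lt i.
  by case: eqP => // ->; rewrite ltnn.
- rewrite /endpoint su pE //; have -> : #|[pred i | y i < m * n + n]| = n.
    by rewrite -[RHS]card_ord; apply: eq_card => i; rewrite !inE y_lt.
  by rewrite addnK.
move=> i; exists (y i); have yi : #|[pred j | y j < y i]| = i.
  have leN : i <= n by exact: ltnW.
  rewrite (@eq_card _ _ [pred j : 'I_n | j < i]); last first.
    by move=> j; rewrite !inE y_mono.
  by rewrite -sum1_card -(big_ord_widen _ (fun=> 1) leN) sum1_card card_ord.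
rewrite su pE ?yi ?(ltnW (y_lt i)) //=; split=> //.
- by rewrite nth_mkseq //; apply/existsP; exists i; rewrite yE.
- by rewrite /y addnK; have := bx i; case: (x i).
Qed.
End Words.

(** * Skeletal paths as words, and the Dyck case k = n - 1 *)

(** (P1) at i = n - 1 bounds the last abscissa by m (n - 1); (P0) and monotonicity give the rest. *)
Lemma skeletal_bounded (m n k : nat) (x : {ffun 'I_n -> int}) :
  skeletal m k x -> forall i, (0 <= x i <= (m * n)%:Z)%R.
Proof.
case=> hx x0 x1 _ i; have n0 : 0 < n by apply: leq_ltn_trans (ltn_ord i).
have ln : n.-1 < n by rewrite prednK.
have := x0 (Ordinal n0) erefl; have := hx (Ordinal n0) i (leq0n _).
have := hx i (Ordinal ln); have := x1 (Ordinal ln) => /=.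
move: (x i) (x (Ordinal n0)) (x (Ordinal ln)) => a b c.
by have := ltn_ord i; move: (nat_of_ord i) => j *; nia.
Qed.

Lemma mem_skeletal_lattice_paths (m n k : nat) (w : word m n) :
  w \in skeletal_lattice_paths m n k <->
  exists x, skeletal m k x /\ augmentation x w.
Proof. by rewrite inE; split=> /asboolP. Qed.

(** For k = n - 1, (P1) says x_i <= m i for every i, and (P2) concerns only i = 0, where (P0) gives
    it with j = 0. *)
Lemma dyck_paths_skeletal (m n : nat) : 0 < n ->
  dyck_paths m n = skeletal_lattice_paths m n (n - 1).
Proof.
move=> n0; apply/setP => w; apply/idP/idP; last first.
  move=> /mem_skeletal_lattice_paths[x [skx aug]]; case: (aug) => u [wu eu ux].
  have su := size_endpoint eu.
  rewrite inE; apply/and3P; split.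
  - rewrite wu /endpoint /point_at take_size -cats1 !count_cat /= !addn0 addn1.
    by case: eu; rewrite take_size => -> ->.
  - apply/forallP => -[p pw]; have pu : p <= size u.
      by move: pw; rewrite wu size_rcons ltnS.
    have -> : point_at w (Ordinal pw) = point_at u p.
      by rewrite /= wu /point_at -cats1 takel_cat.
    have le1 : (point_at u p).1 <= m * n.
      have -> : m * n = (endpoint u).1 by rewrite eu.
      exact: count_take_leq.
    have le2 : (point_at u p).2 <= n.
      have -> : n = (endpoint u).2 by rewrite eu.
      exact: count_take_leq.
    (* At height n the abscissa is at most m n; below, the north step leaving this height comes no
       earlier than [p], and (P1) bounds its abscissa. *)
    have [lt|ge] := ltnP (point_at u p).2 n; last first.
      by apply: leq_trans le1 _; rewrite leq_mul2l ge orbT.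
    have [q [qu uq qx qi]] := ux (Ordinal lt).
    have pq : p <= q.
      rewrite leqNgt; apply/negP => qp.
      have : (point_at u q).2 < (point_at u p).2 by exact: count_take_lt.
      by rewrite qi ltnn.
    apply: leq_trans (count_take_leq _ _ pq) _.
    case: skx => _ _ /(_ (Ordinal lt)) + _; rewrite -qx /= => /(_ ltac:(lia)).
    by rewrite ltz_nat addn1.
  - by rewrite wu last_rcons.
rewrite inE => /and3P[/eqP ew /forallP le /eqP lw].
have [u wu] : exists u, w = rcons u east :> seq bool.
  case/lastP: (tval w) lw => [//|u b]; rewrite last_rcons => ->; by exists u.
have eu : endpoint u = (m * n, n).
  move: ew; rewrite wu /endpoint /point_at !take_size -cats1 !count_cat /=.
  by rewrite !addn0 addn1 => -[-> ->].
have /choice [pos posP] : forall i : 'I_n, exists p,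
    [/\ p < size u, nth east u p = north & (point_at u p).2 = i].
  move=> i; apply: north_step_exists.
  have -> : count_mem north u = n by move: eu => [_]; rewrite take_size.
  exact: ltn_ord.
have bnd i : (point_at u (pos i)).1 <= m * i.
  have [pu up pi] := posP i.
  have pw : pos i < size w by rewrite wu size_rcons ltnS ltnW.
  have := le (Ordinal pw).
  have -> : point_at w (Ordinal pw) = point_at u (pos i).
    by rewrite /= wu /point_at -cats1 takel_cat // ltnW.
  by rewrite pi.
apply/mem_skeletal_lattice_paths.
exists [ffun i => (point_at u (pos i)).1%:Z]%R; split; last first.
  by exists u; split=> // i; exists (pos i); have [] := posP i; rewrite ffunE.
split=> [i j ij|i _|i _|i i0].
- rewrite !ffunE lez_nat /point_at /=; apply: count_take_leq; rewrite leqNgt.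
  have [_ uj pj] := posP j; have [_ _ pi] := posP i.
  apply/negP => ji.
  have : (point_at u (pos j)).2 < (point_at u (pos i)).2.
    exact: count_take_lt.
  by rewrite pi pj ltnNge ij.
- by rewrite ffunE.
- by rewrite ffunE ltz_nat addn1 ltnS bnd.
- exists i; rewrite ffunE; split; [lia|].
  have -> : nat_of_ord i = 0 by lia.
  by rewrite muln0.
Qed.

(** [skeletal_paths] lives in an infinite type, so each path is numbered by the rank of its word in
    the finite set. *)
Lemma card_skeletal_paths (m n k : nat) :
  (skeletal_paths m n k #= `I_#|skeletal_lattice_paths m n k|)%card.
Proof.
set S := skeletal_lattice_paths m n k.
have /choice [f fP] : forall x, exists w : word m n,
    skeletal m k x -> augmentation x w.
  move=> x; case: (pselect (skeletal m k x)) => [skx|nskx]; last first.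
    by exists [tuple east | _ < _].
  have [|w xw] := @augmentation_exists m n x _ (skeletal_bounded skx).
    by case: skx.
  by exists w.
have fS x : skeletal m k x -> f x \in S.
  move=> skx; apply/mem_skeletal_lattice_paths; exists x.
  by split=> //; apply: fP.
pose h x := index (f x) (enum S).
have hlt x : skeletal m k x -> h x < #|S|.
  by move=> skx; rewrite cardE index_mem mem_enum fS.
have -> : (`I_#|S| = h @` skeletal_paths m n k)%classic.
  apply/seteqP; split=> [i /= iS|_ /= [x skx <-]]; last exact: hlt.
  have := enum_valP (Ordinal iS) => /mem_skeletal_lattice_paths[x [skx xw]].
  exists x => //; rewrite /h (augmentation_fun (fP x skx) xw).
  rewrite (enum_val_nth (f x)) index_uniq ?enum_uniq //.
  by rewrite -cardE.
rewrite card_eq_sym; apply: inj_card_eq => x x' /set_mem skx /set_mem skx'.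
rewrite /h => e; have e' : f x = f x'.
  rewrite -(nth_index (f x) (s := enum S) (x := f x)) ?e ?nth_index //;
  by rewrite mem_enum fS.
apply: augmentation_inj (fP x skx) _.
by rewrite e'; apply: fP.
Qed.

(** * Window maxima and the cycle lemma *)

Section WindowMax.
Local Open Scope ring_scope.
Implicit Types (G H : nat -> int) (n k s t i j : nat).

Fixpoint window_max G k i : int :=
  if k is k'.+1 then Order.max (window_max G k' i) (G (i + k)%N) else G i.

Lemma window_max_ge G k i j : (i <= j <= i + k)%N -> G j <= window_max G k i.
Proof.
elim: k => [|k IHk] /= ij; first by have -> : j = i by lia.
rewrite le_max; have [->|ne] := eqVneq j (i + k.+1)%N.
  by rewrite lexx orbT.
by rewrite IHk //; lia.
Qed.

Lemma window_max_attained G k i :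
  exists2 j, (i <= j <= i + k)%N & window_max G k i = G j.
Proof.
elim: k => [|k [j ij e]] /=; first by exists i => //; lia.
rewrite e; case: (leP (G j) (G (i + k.+1)%N)) => _.
  by exists (i + k.+1)%N => //; lia.
by exists j => //; lia.
Qed.

Lemma window_max_period G n k i : (forall j, G (j + n)%N = G j + 1) ->
  window_max G k (i + n) = window_max G k i + 1.
Proof.
move=> per; elim: k => [|k IHk] /=; first exact: per.
by rewrite IHk addnAC per; case: (leP (window_max G k i)); lia.
Qed.

(* The minimum of the [n]-periodic function [n * H s - s] is the last minimum
   of [H] in a period, as [s] breaks ties. *)
Lemma cycle_lemma H n : (0 < n)%N -> (forall j, H (j + n)%N = H j + 1) ->
  exists2 s, (s < n)%N & forall t, (s < t)%N -> H s < H t.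
Proof.
case: n => // n _ per; pose phi s := H s * n.+1%:Z - s%:Z.
have phi_per s q : phi (s + q * n.+1)%N = phi s.
  elim: q => [|q IHq]; first by rewrite mul0n addn0.
  by rewrite mulSn [(n.+1 + _)%N]addnC addnA -[RHS]IHq /phi per; lia.
case: (arg_minP (fun s : 'I_n.+1 => phi s) (erefl : xpredT ord0)) => s _ smin.
exists s => [|t st]; first exact: ltn_ord.
have : phi s <= phi t.
  rewrite [in phi t](divn_eq t n.+1) addnC phi_per.
  by apply: (smin (inZp t)).
by rewrite /phi; move: (H s) (H t) => a b; nia.
Qed.

Lemma cycle_lemma_uniq H n s t : (forall j, H (j + n)%N = H j + 1) ->
  (forall r, (s < r)%N -> H s < H r) -> (forall r, (t < r)%N -> H t < H r) ->
  (s < n)%N -> (t < n)%N -> s = t.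
Proof.
move=> per; wlog st : s t / (s < t)%N => [wl hs ht sn tn|hs ht sn tn].
  by have [st|ts|//] := ltngtP s t; [apply: wl|apply/esym; apply: wl].
have := hs t st; have := ht (s + n)%N.
by rewrite per; lia.
Qed.

(* The conditions (P0)-(P2) on the heights [x_i - m i], read off from
   [G] at the positions [s, ..., s + n - 1] and shifted by [c]. *)
Definition skeletal_window G n k (c : int) s : Prop :=
  [/\ c <= G s,
      forall i, (n - k - 1 <= i < n)%N -> G (s + i)%N <= c
    & forall i, (i <= n - k - 1)%N ->
        exists2 j, (i <= j <= i + k)%N & c <= G (s + j)%N].

(** For k < n this window is s + n - k - 1, ..., s + n - 1, the positions subject to (P1). *)
Definition window_record G n k s : int := window_max G k (s + (n - k - 1)).

Lemma window_record_period G n k s : (forall j, G (j + n)%N = G j + 1) ->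
  window_record G n k (s + n) = window_record G n k s + 1.
Proof. by move=> per; rewrite /window_record addnAC window_max_period. Qed.

(** On the last window (P1) forbids values above c, and (P2) at i = n - k - 1 asks for a value at
    least c. *)
Lemma skeletal_window_record G n k c s : (k < n)%N ->
  skeletal_window G n k c s -> c = window_record G n k s.
Proof.
move=> kn [_ c1 c2]; apply/le_anti/andP; split; rewrite /window_record.
  have [j ij cj] := c2 _ (leqnn _).
  by apply: le_trans cj (window_max_ge _ _); lia.
have [j ij ->] := window_max_attained G k (s + (n - k - 1)).
have -> : j = (s + (j - s))%N by lia.
by apply: c1; lia.
Qed.

(** By integrality G (j + n) > c amounts to G j >= c; this turns (P0) and (P2) into statements on
    later windows. *)
Lemma skeletal_window_cycle G n k s : (k < n)%N ->
  (forall j, G (j + n)%N = G j + 1) ->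
  (exists c, skeletal_window G n k c s) <->
  (forall t, (s < t)%N -> window_record G n k s < window_record G n k t).
Proof.
move=> kn per; split=> [[c sw]|rec].
  rewrite -(skeletal_window_record kn sw); case: sw => c0 c1 c2.
  (* By periodicity it is enough to treat s < t <= s + n. *)
  elim/ltn_ind => t IHt st; have [tsn|] := leqP t (s + n); last first.
    move=> tsn; have -> : t = (t - n + n)%N by lia.
    rewrite window_record_period //.
    by apply: lt_trans (IHt (t - n)%N _ _) _; lia.
  (* For t <= s + k the window of [t] contains s + n, and (P0) applies; otherwise it is the window
     of (P2) at i = t - s - k - 1 moved by n. *)
  have [r_le|r_gt] := leqP t (s + k).
    apply: lt_le_trans (_ : G (s + n)%N <= _); first by rewrite per; lia.
    by apply: window_max_ge; lia.
  have [j ij cj] := c2 (t - s - k - 1)%N ltac:(lia).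
  apply: lt_le_trans (_ : G (s + j + n)%N <= _); first by rewrite per; lia.
  by apply: window_max_ge; lia.
exists (window_record G n k s); split=> [|i ik|i ik].
(* The window of s + 1 gains only s + n over that of s, so its larger maximum is attained there:
   this is (P0). *)
- have := rec s.+1 (ltnSn s); rewrite {2}/window_record.
  have [j ij ->] := window_max_attained G k (s.+1 + (n - k - 1)).
  have [->|ne] := eqVneq j (s + n)%N; first by rewrite per; lia.
  have : G j <= window_record G n k s by apply: window_max_ge; lia.
  by lia.
- by apply: window_max_ge; lia.
(* For this t the window is that of (P2) at i, moved by n. *)
have := rec (s + i + k + 1)%N ltac:(lia); rewrite {2}/window_record.
have -> : (s + i + k + 1 + (n - k - 1) = s + i + n)%N by lia.
rewrite window_max_period //; have [j ij ->] := window_max_attained G k (s + i).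
move=> lt; exists (j - s)%N; first by lia.
by rewrite subnKC; lia.
Qed.

End WindowMax.

(** * Gap sequences and their rotations *)

Section Gaps.
Variables (m p : nat).
Local Notation n := p.+1.
(** No gap exceeds the total m n + 1, so this finite type holds all gap sequences. *)
Local Notation gap_seq := {ffun 'I_n -> 'I_(m * n).+2}.
Implicit Types (d : gap_seq) (x : {ffun 'I_n -> int}) (k j : nat).

(** [inZp] repeats the gaps with period n, so j may exceed n. *)
Definition gap_sum d j : nat := \sum_(0 <= i < j) d (inZp i).

Definition gap_seqs : {set gap_seq} := [set d | gap_sum d n == (m * n).+1]%SET.

Definition rotate d (s : 'I_n) : gap_seq := [ffun i => d (i + s)%R].

(** This fixes all gaps but the last, which membership in [gap_seqs] determines. *)
Definition has_gaps x d : Prop :=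
  forall i : 'I_n, (x i = x ord0 + (gap_sum d i)%:Z)%R.

(** The heights G_i = x_i - m i, up to the constant x_0. *)
Definition slack d i : int := ((gap_sum d i)%:Z - (m * i)%:Z)%R.

Lemma gap_sumS d j : gap_sum d j.+1 = gap_sum d j + d (inZp j).
Proof. by rewrite /gap_sum big_nat_recr. Qed.

Lemma gap_sum0 d : gap_sum d 0 = 0.
Proof. by rewrite /gap_sum big_geq. Qed.

Lemma gap_sum_rotate d (s : 'I_n) j :
  gap_sum d (s + j) = gap_sum d s + gap_sum (rotate d s) j.
Proof.
elim: j => [|j IHj]; first by rewrite addn0 gap_sum0 addn0.
rewrite addnS !gap_sumS IHj -addnA ffunE; congr (_ + (_ + _)).
by congr (nat_of_ord (d _)); apply: val_inj; rewrite /= modnDml addnC.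
Qed.

Lemma gap_sum_total d : gap_sum d n = \sum_(i < n) d i.
Proof.
by rewrite /gap_sum big_mkord; apply: eq_bigr => i _; rewrite valZpK.
Qed.

Lemma gap_sum_period d j : gap_sum d (j + n) = gap_sum d j + gap_sum d n.
Proof.
elim: j => [|j IHj]; first by rewrite gap_sum0.
rewrite addSn (gap_sumS d j) gap_sumS IHj addnAC; congr (_ + _ + _).
by congr (nat_of_ord (d _)); apply: val_inj; rewrite /= modnDr.
Qed.

Lemma gap_sum_homo d i j : i <= j -> gap_sum d i <= gap_sum d j.
Proof.
by move=> ij; rewrite /gap_sum [leqRHS](big_cat_nat (leq0n i) ij) /= leq_addr.
Qed.

Lemma slack_period d j : d \in gap_seqs -> (slack d (j + n) = slack d j + 1)%R.
Proof.
by rewrite inE => /eqP tot; rewrite /slack gap_sum_period tot; lia.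
Qed.

Lemma rotate0 d : rotate d ord0 = d.
Proof. by apply/ffunP => i; rewrite ffunE addr0. Qed.

Lemma rotate_inj (s : 'I_n) : injective (rotate^~ s).
Proof.
move=> d d' /ffunP e; apply/ffunP => i; have := e (i - s)%R.
by rewrite !ffunE subrK.
Qed.

Lemma rotate_gap_seqs d (s : 'I_n) :
  (rotate d s \in gap_seqs) = (d \in gap_seqs).
Proof.
rewrite !inE !gap_sum_total; congr (_ == _).
rewrite [RHS](reindex_inj (addIr s)) /=.
by apply: eq_bigr => i _; rewrite ffunE.
Qed.

Lemma has_gaps_inj x d d' : d \in gap_seqs -> d' \in gap_seqs ->
  has_gaps x d -> has_gaps x d' -> d = d'.
Proof.
rewrite !inE => /eqP tot /eqP tot' xd xd'.
have eqs i : i <= n -> gap_sum d i = gap_sum d' i.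
  rewrite leq_eqVlt => /orP[/eqP->|lt]; first by rewrite tot tot'.
  by have := xd (Ordinal lt); rewrite (xd' (Ordinal lt)) /=; lia.
apply/ffunP => i; apply: val_inj => /=.
have := eqs i.+1 (ltn_ord i); rewrite !gap_sumS (eqs i (ltnW (ltn_ord i))).
by rewrite valZpK => /addnI.
Qed.

Lemma has_gaps_exists x : height_path x ->
  (forall i, 0 <= x i <= (m * n)%:Z)%R ->
  exists2 d, d \in gap_seqs & has_gaps x d.
Proof.
move=> hx bx.
(* The last gap closes the cycle at x_0 + m n + 1; the bounds on [x] keep the subtraction from
   truncating. *)
pose g (i : 'I_n) : nat :=
  if i < p then absz (x (inZp i.+1) - x i)%R
  else (m * n).+1 - absz (x i - x ord0)%R.
have g_lt (i : 'I_n) : g i < (m * n).+2.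
  rewrite /g; case: ifP => _; have := bx i; have := bx (inZp i.+1);
  by have := bx ord0; lia.
pose d : gap_seq := [ffun i : 'I_n => Ordinal (g_lt i)].
have dE i : i < p ->
    (gap_sum d i.+1)%:Z%R = ((gap_sum d i)%:Z + x (inZp i.+1) - x (inZp i))%R.
  move=> ip; rewrite gap_sumS ffunE /= /g /= modn_small ?ip; last by lia.
  have := hx (inZp i) (inZp i.+1); by rewrite /= !modn_small; lia.
have xd : has_gaps x d.
  move=> i; rewrite -[i in x i]valZpK; have := ltn_ord i.
  elim: (nat_of_ord i) => [_|j IHj jp].
    by rewrite gap_sum0 addr0; congr (x _); apply: val_inj.
  by have := IHj (ltnW jp); have := dE j jp; lia.
exists d => //; rewrite inE gap_sumS ffunE /= /g /= modn_small // ltnn.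
have -> : inZp p = ord_max :> 'I_n by apply: val_inj; rewrite /= modn_small.
by have := xd ord_max; have := bx ord_max; have := bx ord0 => /=; lia.
Qed.

(** The gaps of [x] are those of [d] read from s, so the slack at s + i minus this shift is x_i - m
    i. *)
Lemma skeletal_has_gaps_window k x d (s : 'I_n) : k < n ->
  skeletal m k x -> has_gaps x (rotate d s) ->
  skeletal_window (slack d) n k (slack d s - x ord0)%R s.
Proof.
move=> kn [_ x0 x1 x2] gx.
have xE (i : 'I_n) :
    (slack d (s + i) - (slack d s - x ord0) = x i - (m * i)%:Z)%R.
  by rewrite (gx i) /slack gap_sum_rotate; lia.
split=> [|i ik|i ik].
- by have := x0 ord0 erefl; lia.
- have lt : i < n by case/andP: ik.
  by have := xE (Ordinal lt); have := x1 (Ordinal lt) => /=; lia.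
have lt : i < n by lia.
have [j [ij xj]] := x2 (Ordinal lt) ik; exists j => //.
by have := xE j; lia.
Qed.

Lemma skeletal_window_has_gaps k c d (s : 'I_n) : k < n ->
  skeletal_window (slack d) n k c s ->
  exists2 x, skeletal m k x & has_gaps x (rotate d s).
Proof.
move=> kn [c0 c1 c2].
(* Adding m i to the slack gives, up to a constant, a partial sum of gaps: hence monotonicity. *)
exists [ffun i : 'I_n => slack d (s + i) - c + (m * i)%:Z]%R.
  split=> [i j ij|i i0|i ik|i ik].
  - rewrite !ffunE /slack.
    have := @gap_sum_homo d (s + i) (s + j); rewrite leq_add2l => /(_ ij); lia.
  - by rewrite ffunE i0 addn0; lia.
  - by rewrite ffunE; have := c1 i; rewrite ik ltn_ord => /(_ isT); lia.
  have [j ij cj] := c2 _ ik; have jn : j < n by lia.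
  by exists (Ordinal jn); rewrite ffunE /=; split=> //; lia.
by move=> i; rewrite !ffunE /slack gap_sum_rotate /= addn0; lia.
Qed.

(** Equal gaps leave only a translation, and the forced value of the shift c determines x_0. *)
Lemma skeletal_has_gaps_inj k x x' d : k < n ->
  skeletal m k x -> skeletal m k x' -> has_gaps x d -> has_gaps x' d -> x = x'.
Proof.
move=> kn skx skx' gx gx'; apply/ffunP => i; rewrite (gx i) (gx' i).
move: gx gx'; rewrite -{1 2}(rotate0 d).
move=> /(skeletal_has_gaps_window kn skx)/(skeletal_window_record kn) e.
move=> /(skeletal_has_gaps_window kn skx')/(skeletal_window_record kn) e'.
by move: e'; rewrite -e; lia.
Qed.

Definition skeletal_gap_seqs k : {set gap_seq} :=
  [set d in gap_seqs | `[< exists2 x, skeletal m k x & has_gaps x d >]]%SET.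

(** Rotation by s is skeletal when the window record at s is below all later ones; the cycle lemma
    gives exactly one such s < n. *)
Lemma rotate_skeletal_uniq k d : k < n -> d \in gap_seqs ->
  \sum_(s : 'I_n) (rotate d s \in skeletal_gap_seqs k) = 1.
Proof.
move=> kn dG; have per j := slack_period j dG.
have perH j := window_record_period k j per.
have skP (s : 'I_n) : rotate d s \in skeletal_gap_seqs k <->
    forall t, s < t ->
      (window_record (slack d) n k s < window_record (slack d) n k t)%R.
  rewrite -(skeletal_window_cycle s kn per) inE rotate_gap_seqs dG /=.
  split=> [/asboolP[x skx gx]|[c sw]].
    by exists (slack d s - x ord0)%R; apply: skeletal_has_gaps_window.
  by apply/asboolP; apply: skeletal_window_has_gaps sw.
have [s sn sP] := cycle_lemma (ltn0Sn p) perH.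
rewrite (bigD1 (Ordinal sn)) //= big1 => [|t ts].
  by rewrite (_ : _ \in _) // skP.
case: (boolP (_ \in _)) => // /skP tP; case/eqP: ts; apply: val_inj => /=.
exact: cycle_lemma_uniq perH tP sP (ltn_ord t) sn.
Qed.

(** Double counting of the pairs (d, s) for which [rotate d s] is skeletal: each d has one s, and
    rotation by a fixed s is injective. *)
Lemma card_skeletal_gap_seqs k : k < n ->
  n * #|skeletal_gap_seqs k| = #|gap_seqs|.
Proof.
move=> kn; rewrite -[RHS]sum1_card.
transitivity (\sum_(d in gap_seqs) \sum_(s : 'I_n)
    (rotate d s \in skeletal_gap_seqs k : nat)); last first.
  by apply: eq_bigr => d; apply: rotate_skeletal_uniq.
rewrite exchange_big /=.
rewrite (eq_bigr (fun=> #|skeletal_gap_seqs k|)) => [|s _].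
  by rewrite sum_nat_const card_ord.
rewrite -(card_preimset _ (@rotate_inj s)) -[RHS]sum1_card.
rewrite big_mkcond [RHS]big_mkcond.
apply: eq_bigr => d _; rewrite [d \in _ @^-1: _]inE.
have sub : rotate d s \in skeletal_gap_seqs k -> d \in gap_seqs.
  by rewrite inE rotate_gap_seqs => /andP[].
by case: ifPn sub => _; case: (rotate d s \in _) => // /(_ isT).
Qed.

(** A word and a gap sequence are linked through a common skeletal path, which each of them
    determines and which determines both. *)
Lemma card_skeletal_lattice_paths_gaps k : k < n ->
  #|skeletal_lattice_paths m n k| = #|skeletal_gap_seqs k|.
Proof.
move=> kn.
have gap_mem d : d \in skeletal_gap_seqs k ->
    d \in gap_seqs /\ exists2 x, skeletal m k x & has_gaps x d.
  by rewrite inE => /andP[dG /asboolP].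
pose link (w : word m n) d :=
  exists x, [/\ skeletal m k x, augmentation x w & has_gaps x d].
apply/eqP; rewrite eqn_leq; apply/andP; split.
- apply: (@leq_card_rel _ _ _ _ link).
    move=> w /mem_skeletal_lattice_paths[x [skx xw]].
    have [|d dG gx] := has_gaps_exists _ (skeletal_bounded skx).
      by case: skx.
    exists d; last by exists x.
    by rewrite inE dG; apply/asboolP; exists x.
  move=> w w' d _ _ [x [skx xw gx]] [x' [skx' xw' gx']].
  move: xw'; rewrite -(skeletal_has_gaps_inj kn skx skx' gx gx').
  exact: augmentation_fun.
apply: (@leq_card_rel _ _ _ _ (fun d w => link w d)).
  move=> d /gap_mem[dG [x skx gx]].
  have [|w xw] := augmentation_exists _ (skeletal_bounded skx).
    by case: skx.
  exists w; last by exists x.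
  by apply/mem_skeletal_lattice_paths; exists x.
move=> d d' w /gap_mem[dG _] /gap_mem[dG' _] [x [_ xw gx]] [x' [_ xw' gx']].
rewrite -(augmentation_inj xw xw') in gx'.
exact: has_gaps_inj gx gx'.
Qed.

End Gaps.

(** * Comparison of the counts for k and for n - 1 *)

Theorem theorem6p3 (m n k : nat) (hm : 1 <= m) (hn : 1 <= n)
    (hk : k <= n - 1) :
  #|dyck_paths m n| = #|skeletal_lattice_paths m n k| /\
  (skeletal_paths m n k #= `I_#|dyck_paths m n|)%card.
Proof.
case: n hn hk => // p _; rewrite subn1 -ltnS => hk.
have e : #|dyck_paths m p.+1| = #|skeletal_lattice_paths m p.+1 k|.
  rewrite dyck_paths_skeletal // subn1 !card_skeletal_lattice_paths_gaps //.
  (* Multiplied by n > 0, both sides become the number of gap sequences. *)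
  by apply/eqP; rewrite -(eqn_pmul2l (ltn0Sn p)) !card_skeletal_gap_seqs.
by split=> //; rewrite e; apply: card_skeletal_paths.
Qed.
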